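(* Let $F$ be a field of characteristic zero and let $L$ be a three dimensional Lie algebra over $F$. Let $\mathfrak g$ be the three dimensional Lie algebra over $F$ with basis $x,y,z$ and brackets $[x,y]=0$, $[x,z]=x$, $[y,z]=y$. Then $L$ has a plus-minus pair if and only if $L$ is not abelian and $L$ is not isomorphic to $\mathfrak g$.
   Context: For a Lie algebra $\mathfrak a$ over $F$, $U(\mathfrak a)$ denotes its universal enveloping algebra; for a subalgebra $\mathfrak b\subseteq\mathfrak a$, $U(\mathfrak b)$ is regarded as a subalgebra of $U(\mathfrak a)$. For subspaces $A,B$ of $U(\mathfrak a)$, $AB$ denotes the linear span of all products $ab$ with $a\in A$, $b\in B$. A Lie algebra $L$ has a plus-minus pair $(P,M)$ if $P,M$ are subalgebras of $L$ with $P+M\neq L$ (vector space sum) and $U(L)=U(P)U(M)U(P)$. *)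

(* Defs.v *)
From HB Require Import structures.
From mathcomp Require Import all_boot all_order all_algebra.
From mathcomp Require Import boolp classical_sets monalg ring.

Set Implicit Arguments.
Unset Strict Implicit.
Unset Printing Implicit Defensive.

Import GRing.Theory.
Local Open Scope ring_scope.
Local Open Scope quotient_scope.

HB.mixin Record isLieAlgebra (F : fieldType) L of GRing.Lmodule F L := {
  lie : L -> L -> L;
  lie_linearl : forall v : L, linear (lie ^~ v);
  lie_linearr : forall u : L, linear (lie u);
  liexx : forall u : L, lie u u = 0;
  lie_jacobi : forall u v w : L,
    lie u (lie v w) + lie v (lie w u) + lie w (lie u v) = 0
}.

#[short(type="lieAlgType")]
HB.structure Definition LieAlgebra (F : fieldType) :=
  {L of isLieAlgebra F L & GRing.Lmodule F L}.

#[short(type="lieVectType")]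
HB.structure Definition LieVector (F : fieldType) :=
  {L of LieAlgebra F L & Vector F L}.

Definition lie_abelian (F : fieldType) (L : lieAlgType F) : Prop :=
  forall u v : L, lie u v = 0.

Definition lie_morphism (F : fieldType) (L L' : lieAlgType F) (f : L -> L') :
  Prop := forall u v, f (lie u v) = lie (f u) (f v).

Definition lie_isomorphic (F : fieldType) (L L' : lieAlgType F) : Prop :=
  exists f : {linear L -> L'}, lie_morphism f /\ bijective f.

Record lieSubalg (F : fieldType) (L : lieVectType F) := LieSubalg {
  lieSubalg_vs :> {vspace L};
  lieSubalgP : forall u v, u \in lieSubalg_vs -> v \in lieSubalg_vs ->
    lie u v \in lieSubalg_vs
}.

Section SubalgebraLie.
Context (F : fieldType) (L : lieVectType F) (P : lieSubalg L).
Implicit Types u v w : subvs_of P.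

Definition subvs_lie u v : subvs_of P :=
  Subvs (lieSubalgP (subvsP u) (subvsP v)).

Fact subvs_lie_linearl v : linear (subvs_lie ^~ v).
Proof. by move=> a u w; apply: subvs_inj; rewrite /= lie_linearl. Qed.

Fact subvs_lie_linearr u : linear (subvs_lie u).
Proof. by move=> a v w; apply: subvs_inj; rewrite /= lie_linearr. Qed.

Fact subvs_liexx u : subvs_lie u u = 0.
Proof. by apply: subvs_inj; rewrite /= liexx. Qed.

Fact subvs_lie_jacobi u v w :
  subvs_lie u (subvs_lie v w) + subvs_lie v (subvs_lie w u)
    + subvs_lie w (subvs_lie u v) = 0.
Proof. by apply: subvs_inj; rewrite /= lie_jacobi. Qed.

HB.instance Definition _ := isLieAlgebra.Build F (subvs_of P)
  subvs_lie_linearl subvs_lie_linearr subvs_liexx subvs_lie_jacobi.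

Lemma vsval_lie_morphism : lie_morphism (vsval : subvs_of P -> L).
Proof. by []. Qed.

End SubalgebraLie.

(* The universal enveloping algebra is the free associative unital F-algebra
   on the set L, modulo the two-sided ideal which makes the inclusion of the
   generators F-linear (that quotient alone is the tensor algebra T(L)) and
   turns brackets into commutators. *)
Section Envelope.
Context (F : fieldType) (L : lieAlgType F).

Local Notation T := {malg F[{fmonom L}]}.

Definition free_gen (u : L) : T := << fmu u >>.

Variant env_relator : T -> Prop :=
  | EnvLinear a u v : env_relator
      (free_gen (a *: u + v) - (a *: free_gen u + free_gen v))
  | EnvLie u v : env_relator
      (free_gen (lie u v)
         - (free_gen u * free_gen v - free_gen v * free_gen u)).

Inductive env_ideal : T -> Prop :=
  | EnvRelator r : env_relator r -> env_ideal r
  | Env0 : env_ideal 0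
  | EnvD r s : env_ideal r -> env_ideal s -> env_ideal (r + s)
  | EnvMl t r : env_ideal r -> env_ideal (t * r)
  | EnvMr t r : env_ideal r -> env_ideal (r * t).

Definition env_idealb (t : T) : bool := `[< env_ideal t >].

Fact env_idealb_zmod : zmod_closed env_idealb.
Proof.
split=> [|x y /asboolP x0 /asboolP y0]; apply/asboolP; first exact: Env0.
by apply: EnvD => //; rewrite -mulN1r; apply: EnvMl.
Qed.

HB.instance Definition _ := GRing.isZmodClosed.Build T env_idealb
  env_idealb_zmod.

Definition env_zmod : zmodClosed T := GRing.ZmodClosed.clone T env_idealb _.

Definition uenv : Type := Quotient.quot env_zmod.

HB.instance Definition _ : EqQuotient T (Quotient.equiv env_zmod) uenv :=
  EqQuotient.on uenv.
HB.instance Definition _ := Choice.on uenv.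
HB.instance Definition _ := GRing.Zmodule.on uenv.

Definition uenv_pi (t : T) : uenv := \pi_(Quotient.quot env_zmod) t.

Lemma uenv_piP s t : uenv_pi s = uenv_pi t <-> env_ideal (s - t).
Proof.
rewrite /uenv_pi; split=> [/eqP|] st; last first.
  by apply/eqP; rewrite -Quotient.idealrBE; apply/asboolP.
by apply/asboolP; move: st; rewrite -Quotient.idealrBE.
Qed.

Lemma uenv_piK (q : uenv) : uenv_pi (repr q) = q.
Proof. exact: reprK. Qed.

Lemma uenv_piB : {morph uenv_pi : x y / x - y}.
Proof. by move=> x y; rewrite /uenv_pi raddfB. Qed.

Lemma uenv_piD : {morph uenv_pi : x y / x + y}.
Proof. by move=> x y; rewrite /uenv_pi raddfD. Qed.

Definition uenv_one : uenv := uenv_pi 1.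
Definition uenv_mul (p q : uenv) : uenv := uenv_pi (repr p * repr q).
Definition uenv_scale (a : F) (q : uenv) : uenv := uenv_pi (a *: repr q).

Lemma uenv_piM s t : uenv_pi (s * t) = uenv_mul (uenv_pi s) (uenv_pi t).
Proof.
apply/uenv_piP; set s' := repr _; set t' := repr _.
have -> : s * t - s' * t' = (s - s') * t + s' * (t - t').
  by rewrite mulrBl mulrBr addrA subrK.
by apply: EnvD; [apply: EnvMr|apply: EnvMl]; apply/uenv_piP;
  rewrite uenv_piK.
Qed.

Lemma uenv_piZ a t : uenv_pi (a *: t) = uenv_scale a (uenv_pi t).
Proof.
apply/uenv_piP; rewrite -scalerBr -mul_malgC; apply: EnvMl.
by apply/uenv_piP; rewrite uenv_piK.
Qed.

Fact uenv_mulA : associative uenv_mul.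
Proof.
move=> p q r; rewrite -[p]uenv_piK -[q]uenv_piK -[r]uenv_piK.
by rewrite -!uenv_piM mulrA.
Qed.

Fact uenv_mul1 : left_id uenv_one uenv_mul.
Proof. by move=> p; rewrite -[p]uenv_piK -!uenv_piM mul1r. Qed.

Fact uenv_mulr1 : right_id uenv_one uenv_mul.
Proof. by move=> p; rewrite -[p]uenv_piK -!uenv_piM mulr1. Qed.

Fact uenv_mulDl : left_distributive uenv_mul +%R.
Proof.
move=> p q r; rewrite -[p]uenv_piK -[q]uenv_piK -[r]uenv_piK.
by rewrite -!uenv_piM -!uenv_piD -uenv_piM mulrDl.
Qed.

Fact uenv_mulDr : right_distributive uenv_mul +%R.
Proof.
move=> p q r; rewrite -[p]uenv_piK -[q]uenv_piK -[r]uenv_piK.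
by rewrite -!uenv_piM -!uenv_piD -uenv_piM mulrDr.
Qed.

Lemma env_ideal_mcoeff1 t : env_ideal t -> @mcoeff {fmonom L} F mone t = 0.
Proof.
have gen0 u : @mcoeff {fmonom L} F mone (free_gen u) = 0.
  by rewrite mcoeffU1 -fdeg_eq0 fdegU.
elim=> {t} [_ [a u v|u v]||r s _ r0 _ s0|t r _ r0|t r _ r0].
- by rewrite mcoeffB mcoeffD mcoeffZ !gen0 mulr0 addr0 subr0.
- by rewrite !mcoeffB !(rmorphM (@mcoeff {fmonom L} F mone)) /= !gen0 mulr0 !subr0.
- exact: mcoeff0.
- by rewrite mcoeffD r0 s0 addr0.
- by rewrite (rmorphM (@mcoeff {fmonom L} F mone)) /= r0 mulr0.
- by rewrite (rmorphM (@mcoeff {fmonom L} F mone)) /= r0 mul0r.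
Qed.

Fact uenv_one_neq0 : uenv_one != 0.
Proof.
apply/eqP; rewrite /uenv_one.
have -> : (0 : uenv) = uenv_pi 0 by rewrite /uenv_pi raddf0.
move=> /uenv_piP /env_ideal_mcoeff1 /eqP.
by rewrite subr0 mcoeff1 eqxx oner_eq0.
Qed.

HB.instance Definition _ := GRing.Zmodule_isNzRing.Build uenv
  uenv_mulA uenv_mul1 uenv_mulr1 uenv_mulDl uenv_mulDr uenv_one_neq0.

Fact uenv_scaleA a b q : uenv_scale a (uenv_scale b q) = uenv_scale (a * b) q.
Proof. by rewrite -[q]uenv_piK -!uenv_piZ scalerA. Qed.

Fact uenv_scale1 : left_id 1 uenv_scale.
Proof. by move=> q; rewrite -[q]uenv_piK -!uenv_piZ scale1r. Qed.

Fact uenv_scaleDr : right_distributive uenv_scale +%R.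
Proof.
move=> a p q; rewrite -[p]uenv_piK -[q]uenv_piK.
by rewrite -!uenv_piZ -!uenv_piD -uenv_piZ scalerDr.
Qed.

Fact uenv_scaleDl q : {morph uenv_scale^~ q : a b / a + b}.
Proof.
by move=> a b; rewrite -[q]uenv_piK -!uenv_piZ -uenv_piD scalerDl.
Qed.

HB.instance Definition _ := GRing.Zmodule_isLmodule.Build F uenv
  uenv_scaleA uenv_scale1 uenv_scaleDr uenv_scaleDl.

Fact uenv_scaleAl a (p q : uenv) : a *: (p * q) = (a *: p) * q.
Proof.
rewrite -[p]uenv_piK -[q]uenv_piK /GRing.mul /GRing.scale /=.
by rewrite -uenv_piM -!uenv_piZ -uenv_piM scalerAl.
Qed.

HB.instance Definition _ := GRing.Lmodule_isLalgebra.Build F uenv uenv_scaleAl.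

Lemma malgC_comm a (s : T) : s * malgC a = malgC a * s.
Proof.
rewrite !malgM_def fgmulUg fgmulgU.
by apply: eq_bigr => k _; rewrite mulm1 mul1m mulrC.
Qed.

Lemma malg_scaleAr a (s t : T) : a *: (s * t) = s * (a *: t).
Proof. by rewrite -!mul_malgC !mulrA malgC_comm. Qed.

Fact uenv_scaleAr a (p q : uenv) : a *: (p * q) = p * (a *: q).
Proof.
rewrite -[p]uenv_piK -[q]uenv_piK /GRing.mul /GRing.scale /=.
by rewrite -uenv_piM -!uenv_piZ -uenv_piM malg_scaleAr.
Qed.

HB.instance Definition _ := GRing.Lalgebra_isAlgebra.Build F uenv uenv_scaleAr.

Definition uenv_in (u : L) : uenv := uenv_pi (free_gen u).

Fact uenv_in_linear : linear uenv_in.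
Proof.
move=> a u v; rewrite /uenv_in /GRing.scale /= -uenv_piZ -uenv_piD.
by apply/uenv_piP; apply: EnvRelator; apply: EnvLinear.
Qed.

HB.instance Definition _ := GRing.isLinear.Build F L uenv *:%R uenv_in
  uenv_in_linear.

Lemma uenv_in_lie u v :
  uenv_in (lie u v) = uenv_in u * uenv_in v - uenv_in v * uenv_in u.
Proof.
rewrite /uenv_in /GRing.mul /= -!uenv_piM -uenv_piB.
by apply/uenv_piP; apply: EnvRelator; apply: EnvLie.
Qed.

End Envelope.

Section UniversalProperty.
Context (F : fieldType) (L : lieAlgType F) (A : algType F).

Local Notation T := {malg F[{fmonom L}]}.

Definition fmonom_prod (f : L -> A) (m : {fmonom L}) : A := \prod_(i <- m) f i.

Definition free_lift (f : L -> A) : T -> A := mmap (in_alg A) (fmonom_prod f).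

(* Meaningful when f is linear and sends brackets to commutators; see
   uenv_universal. *)
Definition uenv_lift (f : L -> A) (q : uenv L) : A := free_lift f (repr q).

Section Lift.
Variable f : L -> A.

Fact fmonom_prod_mmorphism : mmorphism (fmonom_prod f).
Proof.
by split=> [m n|]; rewrite /fmonom_prod ?fmM ?big_cat //= fm1 big_nil.
Qed.

HB.instance Definition _ := isMultiplicative.Build {fmonom L} A (fmonom_prod f)
  fmonom_prod_mmorphism.


Fact free_lift_linear : linear (free_lift f).
Proof.
move=> a s t; rewrite /free_lift raddfD /=; congr (_ + _).
by rewrite -[RHS]mulr_algl; apply: (mmapZ (f := in_alg A)).
Qed.

HB.instance Definition _ := GRing.isLinear.Build F T A *:%R (free_lift f)
  free_lift_linear.

Fact free_lift_monoid_morphism : monoid_morphism (free_lift f).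
Proof.
have comm (g : T) (m m' : {fmonom L}) :
  GRing.comm (in_alg A (mcoeff m g)) (fmonom_prod f m').
  by rewrite /GRing.comm /= mulr_algl mulr_algr.
by have [M1 M2] := commr_mmap_is_multiplicative comm; split.
Qed.

HB.instance Definition _ := GRing.isMonoidMorphism.Build T A (free_lift f)
  free_lift_monoid_morphism.

Lemma free_lift_gen u : free_lift f (free_gen u) = f u.
Proof.
by rewrite /free_lift mmapU /= scale1r mul1r /fmonom_prod fmU big_seq1.
Qed.

Hypothesis f_linear : linear f.
Hypothesis f_lie : forall u v, f (lie u v) = f u * f v - f v * f u.

Lemma free_lift_ideal t : env_ideal t -> free_lift f t = 0.
Proof.
elim=> {t} [_ [a u v|u v]||r s _ r0 _ s0|t r _ r0|t r _ r0].
- by rewrite raddfB /= free_lift_linear !free_lift_gen f_linear subrr.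
- by rewrite raddfB /= raddfB /= !rmorphM /= !free_lift_gen f_lie subrr.
- exact: raddf0.
- by rewrite raddfD /= r0 s0 addr0.
- by rewrite rmorphM /= r0 mulr0.
- by rewrite rmorphM /= r0 mul0r.
Qed.

Lemma uenv_lift_pi t : uenv_lift f (uenv_pi t) = free_lift f t.
Proof.
apply/eqP; rewrite -subr_eq0 /uenv_lift -raddfB; apply/eqP/free_lift_ideal.
by apply/uenv_piP; rewrite uenv_piK.
Qed.

Lemma uenv_lift_in u : uenv_lift f (uenv_in u) = f u.
Proof. by rewrite uenv_lift_pi free_lift_gen. Qed.

Lemma uenv_lift_linear : linear (uenv_lift f).
Proof.
move=> a p q; rewrite -[p]uenv_piK -[q]uenv_piK {1}/GRing.scale /=.
by rewrite -uenv_piZ -uenv_piD !uenv_lift_pi linearP.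
Qed.

Lemma uenv_lift_monoid_morphism : monoid_morphism (uenv_lift f).
Proof.
split=> [|p q]; first by rewrite uenv_lift_pi rmorph1.
rewrite -[p]uenv_piK -[q]uenv_piK {1}/GRing.mul /=.
by rewrite -uenv_piM !uenv_lift_pi rmorphM.
Qed.

End Lift.

Lemma uenv_ind (S : uenv L -> Prop) :
  S 1 -> (forall a p q, S p -> S q -> S (a *: p + q)) ->
  (forall p q, S p -> S q -> S (p * q)) -> (forall u, S (uenv_in u)) ->
  forall q, S q.
Proof.
move=> S1 SD SM Sin q.
have S0 : S 0 by rewrite -(addNr 1) -scaleN1r; apply: SD.
rewrite -[q]uenv_piK [repr q]monalgE /uenv_pi raddf_sum /=.
apply: big_rec => // m p _ Sp; set c := mcoeff _ _.
have -> : << c *g m >> = c *: << m >> :> T.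
  by apply/malgP => k; rewrite mcoeffZ !mcoeffU mulrnAr mulr1.
rewrite -[\pi_ _ _]/(uenv_pi _) uenv_piZ; apply: SD => // {p Sp q c}.
case: m => s; elim: s => [|u s IHs].
  by move: S1; rewrite /GRing.one /= /uenv_one /GRing.one /= /fgone
    /mone /= fmoneE.
have -> : << FMonom (u :: s) >> = free_gen u * << FMonom s >> :> T.
  by rewrite malgM_def fgmulUU mul1r /mmul /= fmmulE fmU.
by rewrite uenv_piM; apply: SM IHs; apply: Sin.
Qed.

Theorem uenv_universal (f : L -> A) :
    linear f -> (forall u v, f (lie u v) = f u * f v - f v * f u) ->
  (exists g : {lrmorphism uenv L -> A}, forall u, g (uenv_in u) = f u) /\
  (forall g h : {lrmorphism uenv L -> A},
     (forall u, g (uenv_in u) = f u) -> (forall u, h (uenv_in u) = f u) ->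
   g =1 h).
Proof.
move=> f_linear f_lie; split=> [|g h gf hf].
  pose g1 := GRing.isLinear.Build F (uenv L) A *:%R (uenv_lift f)
    (uenv_lift_linear f_linear f_lie).
  pose g2 := GRing.isMonoidMorphism.Build (uenv L) A (uenv_lift f)
    (uenv_lift_monoid_morphism f_linear f_lie).
  pose g : {lrmorphism uenv L -> A} := HB.pack (uenv_lift f) g1 g2.
  by exists g => u; apply: uenv_lift_in.
apply: uenv_ind => [|a p q pE qE|p q pE qE|u].
- by rewrite !rmorph1.
- by rewrite !linearP /= pE qE.
- by rewrite !rmorphM /= pE qE.
- by rewrite gf hf.
Qed.

End UniversalProperty.

(* The algebra map U(L) -> U(L') induced by a Lie algebra morphism f. *)
Definition uenv_map (F : fieldType) (L L' : lieAlgType F) (f : {linear L -> L'}) :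
  uenv L -> uenv L' := uenv_lift (fun u => uenv_in (f u)).

Lemma uenv_map_in (F : fieldType) (L L' : lieAlgType F) (f : {linear L -> L'}) :
  lie_morphism f -> forall u, uenv_map f (uenv_in u) = uenv_in (f u).
Proof.
move=> f_lie; apply: uenv_lift_in => [a u v|u v]; first by rewrite !linearP.
by rewrite f_lie uenv_in_lie.
Qed.

Local Open Scope classical_set_scope.

Section PlusMinus.
Context (F : fieldType) (L : lieVectType F).

(* U(P), viewed inside U(L) as the image of the map induced by P -> L. *)
Definition uenv_sub (P : lieSubalg L) : set (uenv L) :=
  range (uenv_map (vsval : {linear subvs_of P -> L})).

Definition span_mul (A B : set (uenv L)) : set (uenv L) :=
  [set q | exists n (c : 'I_n -> F) (a b : 'I_n -> uenv L),
     [/\ forall i, A (a i), forall i, B (b i)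
       & q = \sum_(i < n) c i *: (a i * b i)]].

Definition plus_minus_pair (P M : lieSubalg L) : Prop :=
  (P + M)%VS <> fullv /\
  [set: uenv L] = span_mul (span_mul (uenv_sub P) (uenv_sub M)) (uenv_sub P).

Definition has_plus_minus_pair : Prop :=
  exists P M : lieSubalg L, plus_minus_pair P M.

End PlusMinus.

(* On row vectors u = (u_x, u_y, u_z), the bilinear extension of the brackets
   [x, y] = 0, [x, z] = x, [y, z] = y of the basis vectors is
   [u, v] = v_z u - u_z v; see lie_g_basis, lie_g_xy, lie_g_xz, lie_g_yz. *)
Definition lie_g (F : fieldType) : Type := 'rV[F]_3.

Section LieG.
Context (F : fieldType).

HB.instance Definition _ := Vector.on (lie_g F).

Implicit Types u v w : 'rV[F]_3.

Definition lie_g_bracket u v : 'rV[F]_3 := v 0 2 *: u - u 0 2 *: v.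

Fact lie_g_linearl v : linear (lie_g_bracket ^~ v).
Proof. by move=> a u w; apply/rowP => i; rewrite !mxE; ring. Qed.

Fact lie_g_linearr u : linear (lie_g_bracket u).
Proof. by move=> a v w; apply/rowP => i; rewrite !mxE; ring. Qed.

Fact lie_g_xx u : lie_g_bracket u u = 0.
Proof. exact: subrr. Qed.

Fact lie_g_jacobi u v w :
  lie_g_bracket u (lie_g_bracket v w) + lie_g_bracket v (lie_g_bracket w u)
    + lie_g_bracket w (lie_g_bracket u v) = 0.
Proof. by apply/rowP => i; rewrite !mxE; ring. Qed.

HB.instance Definition _ := isLieAlgebra.Build F (lie_g F)
  lie_g_linearl lie_g_linearr lie_g_xx lie_g_jacobi.

Definition lie_g_x : lie_g F := delta_mx 0 0.
Definition lie_g_y : lie_g F := delta_mx 0 1.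
Definition lie_g_z : lie_g F := delta_mx 0 2.

Lemma lie_g_basis : basis_of fullv [:: lie_g_x; lie_g_y; lie_g_z].
Proof.
rewrite basisEdim dimvf /dim /= mul1n leqnn andbT; apply/subvP => u _.
have -> : u = (u : 'rV_3) 0 0 *: lie_g_x + ((u : 'rV_3) 0 1 *: lie_g_y
                + (u : 'rV_3) 0 2 *: lie_g_z).
  apply/rowP => i; rewrite !mxE /= (_ : i = [:: 0; 1; 2]`_i).
    by case: i => [[|[|[|//]]] ilt] /=; rewrite ?(mulr0, mulr1, addr0, add0r).
  by apply: val_inj; case: i => [[|[|[|//]]] ilt].
by rewrite !memvD ?memvZ ?memv_span ?inE ?eqxx ?orbT.
Qed.

Lemma lie_g_xy : lie lie_g_x lie_g_y = 0.
Proof. by apply/rowP => i; rewrite !mxE /=; ring. Qed.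

Lemma lie_g_xz : lie lie_g_x lie_g_z = lie_g_x.
Proof. by apply/rowP => i; rewrite !mxE /=; ring. Qed.

Lemma lie_g_yz : lie lie_g_y lie_g_z = lie_g_y.
Proof. by apply/rowP => i; rewrite !mxE /=; ring. Qed.

End LieG.

(* Main.v *)
(* If every bracket [u, v] lies in the span of u and v, then
   [u, v] = z(v) u - z(u) v for some linear functional z: this is the abelian
   algebra when z = 0 and g otherwise. For such L, and P + M contained in the
   kernel of a linear functional f <> 0, the representation
   u |-> [[-z(u), f(u)], [0, 0]] maps U(P)U(M)U(P) to diagonal matrices, but not
   U(L).
   Otherwise some u, v, w = [u, v] form a basis, and the lines P = <u>, M = <v>
   are a plus-minus pair: filtering U(L) by the length of words in u and v, the
   element w is central modulo shorter words, as in the Heisenberg algebra, and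
     (j+1) v u^i v^j = (j+1-i) u^i v^(j+1) + i u^(i-1) v^(j+1) u
   modulo shorter words, so that in characteristic zero the span of the
   u^i v^j u^k is stable under left multiplication by v. *)
Require Import Defs.
From HB Require Import structures.
From mathcomp Require Import all_boot all_order all_algebra.
From mathcomp Require Import boolp classical_sets ring.

Set Implicit Arguments.
Unset Strict Implicit.
Unset Printing Implicit Defensive.

Import GRing.Theory.
Local Open Scope ring_scope.

(** * Word-length filtration, and straightening of words in two generators *)

Section TwoGenerators.
Context (F : fieldType) (A : algType F) (u v : A).

(** The filtration is inductive so that facts about words follow by induction on derivations.
    Letters are added on the left only; [wordsM] recovers general products. *)
Inductive words_le : nat -> A -> Prop :=
| words1 : words_le 0 1
| wordsP n a p q : words_le n p -> words_le n q -> words_le n (a *: p + q)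
| wordsS n p : words_le n p -> words_le n.+1 p
| words_mull n p : words_le n p -> words_le n.+1 (u * p)
| words_mulr n p : words_le n p -> words_le n.+1 (v * p).

Lemma words0 n : words_le n 0.
Proof.
elim: n => [|n /wordsS//].
by rewrite -(addNr 1) -scaleN1r; apply: wordsP; apply: words1.
Qed.

Lemma wordsZ n a p : words_le n p -> words_le n (a *: p).
Proof. by move=> Wp; rewrite -[_ *: _]addr0; apply: wordsP (words0 n). Qed.

Lemma wordsD n p q : words_le n p -> words_le n q -> words_le n (p + q).
Proof. by rewrite -{2}[p]scale1r; apply: wordsP. Qed.

Lemma wordsB n p q : words_le n p -> words_le n q -> words_le n (p - q).
Proof. by rewrite -scaleN1r addrC => Wp Wq; apply: wordsP. Qed.

Lemma words_leq m n p : (m <= n)%N -> words_le m p -> words_le n p.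
Proof. by move=> /subnK <-; elim: (n - m)%N => // k IH /IH/wordsS. Qed.

Lemma wordsM m n p q :
  words_le m p -> words_le n q -> words_le (m + n) (p * q).
Proof.
move=> Wp Wq; elim: Wp => {m p}.
- by rewrite mul1r.
- by move=> m a p r _ Wp _ Wr; rewrite mulrDl -scalerAl; apply: wordsP.
- by move=> m p _; apply: wordsS.
- by move=> m p _; rewrite -mulrA; apply: words_mull.
- by move=> m p _; rewrite -mulrA; apply: words_mulr.
Qed.

Lemma words_u : words_le 1 u.
Proof. by rewrite -[u]mulr1; apply/words_mull/words1. Qed.

Lemma words_v : words_le 1 v.
Proof. by rewrite -[v]mulr1; apply/words_mulr/words1. Qed.

Lemma wordsX p n : words_le 1 p -> words_le n (p ^+ n).
Proof.
move=> Wp; elim: n => [|n IH]; first exact: words1.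
by rewrite exprS; apply: (@wordsM 1).
Qed.

Inductive sandwich_le (n : nat) : A -> Prop :=
| sandwich0 : sandwich_le n 0
| sandwichP a p q :
    sandwich_le n p -> sandwich_le n q -> sandwich_le n (a *: p + q)
| sandwich_monomial i j k :
    (i + j + k <= n)%N -> sandwich_le n (u ^+ i * v ^+ j * u ^+ k).

Lemma sandwichZ n a p : sandwich_le n p -> sandwich_le n (a *: p).
Proof.
by move=> Sp; rewrite -[_ *: _]addr0; apply: sandwichP (sandwich0 n).
Qed.

Lemma sandwichD n p q :
  sandwich_le n p -> sandwich_le n q -> sandwich_le n (p + q).
Proof. by rewrite -{2}[p]scale1r; apply: sandwichP. Qed.

Lemma sandwich_leq m n p : (m <= n)%N -> sandwich_le m p -> sandwich_le n p.
Proof.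
move=> le_mn; elim=> {p} [|a p q _ Sp _ Sq|i j k le_m]; first exact: sandwich0.
  exact: sandwichP.
by apply: sandwich_monomial; apply: leq_trans le_mn.
Qed.

Variable w : A.
Hypothesis comm_uv : u * v - v * u = w.
Hypothesis comm_uw : words_le 2 (u * w - w * u).
Hypothesis comm_vw : words_le 2 (v * w - w * v).

(** Passing [v] across one more [u] creates one more [w], and moving the earlier copies of [w] to
    the right of that [u] costs [u * w - w * u]. As [w] counts for two letters, [comm_uw] makes this
    cost one letter shorter than the terms displayed. *)
Lemma comm_vX i : words_le i.+1
  (v * u ^+ i.+1 - u ^+ i.+1 * v + i.+1%:R *: (u ^+ i * w)).
Proof.
elim: i => [|i IH].
  by rewrite !expr1 scale1r mul1r -comm_uv addrA subrK subrr; apply: words0.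
pose c : F := i.+1%:R.
have -> : v * u ^+ i.+2 - u ^+ i.+2 * v + i.+2%:R *: (u ^+ i.+1 * w)
  = (v * u ^+ i.+1 - u ^+ i.+1 * v + c *: (u ^+ i * w)) * u
    + c *: (u ^+ i * (u * w - w * u)).
  rewrite [u ^+ i.+2]exprSr; set U := u ^+ i.+1.
  have -> : u ^+ i * (u * w - w * u) = U * w - u ^+ i * w * u.
    by rewrite mulrBr /U exprSr !mulrA.
  rewrite -natr1 scalerDl scale1r !mulrDl mulNr -/c scalerBr -scalerAl !mulrA.
  have -> : U * u * v = U * v * u + U * w.
    by rewrite -!mulrA -mulrDr -comm_uv addrC subrK.
  by rewrite opprD !addrA [LHS]addrAC subrK [RHS]addrAC addrK.
apply: wordsD; first by rewrite -[i.+2]addn1; apply: wordsM words_u.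
by apply/wordsZ; rewrite -[i.+2]addn2; apply: wordsM => //;
  apply/wordsX/words_u.
Qed.

(** Mirror image of [comm_vX]: the recursion multiplies by [v] on the left, and the correction comes
    from [v * w - w * v]. *)
Lemma comm_Xu j : words_le j.+1
  (v ^+ j.+1 * u - u * v ^+ j.+1 + j.+1%:R *: (w * v ^+ j)).
Proof.
elim: j => [|j IH].
  by rewrite !expr1 scale1r mulr1 -comm_uv addrA subrK subrr; apply: words0.
pose c : F := j.+1%:R.
have -> : v ^+ j.+2 * u - u * v ^+ j.+2 + j.+2%:R *: (w * v ^+ j.+1)
  = v * (v ^+ j.+1 * u - u * v ^+ j.+1 + c *: (w * v ^+ j))
    - c *: ((v * w - w * v) * v ^+ j).
  rewrite [v ^+ j.+2]exprS; set V := v ^+ j.+1.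
  have -> : (v * w - w * v) * v ^+ j = v * (w * v ^+ j) - w * V.
    by rewrite mulrBl /V exprS !mulrA.
  rewrite -natr1 scalerDl scale1r !mulrDr mulrN -/c scalerBr -scalerAr !mulrA.
  have -> : u * v * V = v * u * V + w * V.
    by rewrite -mulrDl -comm_uv addrC subrK.
  by rewrite opprD !addrA opprB addrA [LHS]addrAC subrK [RHS]addrAC addrK.
apply: wordsB; first exact: (@wordsM 1 _ _ _ words_v IH).
by apply: wordsZ; apply: (@wordsM 2) => //; apply/wordsX/words_v.
Qed.

(* Modulo shorter words [w] is central, so that eliminating it between
   [v u^i = u^i v - i u^(i-1) w] and [v^(j+1) u = u v^(j+1) - (j+1) w v^j]
   expresses [v u^i v^j] through sandwiches. *)
Lemma mul_v_sandwich i j : words_le (i.+1 + j)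
  (j.+1%:R *: (v * u ^+ i.+1 * v ^+ j)
   - ((j.+1%:R - i.+1%:R) *: (u ^+ i.+1 * v ^+ j.+1)
      + i.+1%:R *: (u ^+ i * v ^+ j.+1 * u))).
Proof.
have Wv := wordsZ j.+1%:R (wordsM (comm_vX i) (wordsX j words_v)).
have Wu := wordsZ i.+1%:R (wordsM (wordsX i words_u) (comm_Xu j)).
have := wordsB Wv _; rewrite addSnnS => /(_ _ Wu).
set c : F := i.+1%:R; set d : F := j.+1%:R.
congr (words_le _ _); rewrite !mulrDl !mulrDr !mulNr !mulrN !scalerDr !scalerN.
rewrite -!scalerAl -!scalerAr !scalerA [d * c]mulrC !mulrA -exprSr.
rewrite -[u ^+ i.+1 * v * _]mulrA -exprS opprD addrACA subrr addr0 scalerBl.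
rewrite !opprD !opprK -!addrA; congr (_ + _); congr (_ + _).
by rewrite addrC.
Qed.

Hypothesis charF0 : [pchar F] =i pred0.

(** Strong induction on the length, with an inner induction on the derivation. Only left
    multiplication of a sandwich by [v] needs an argument; the shorter words it leaves behind are
    covered by the outer induction. *)
Lemma words_sandwich n q : words_le n q -> sandwich_le n q.
Proof.
elim/ltn_ind: n q => n IH q Wq; elim: Wq IH => {n q}.
- by move=> _; have := @sandwich_monomial 0 0 0 0 isT; rewrite !mulr1.
- by move=> n a p q _ Sp _ Sq IH; apply: sandwichP; [apply: Sp|apply: Sq].
- by move=> n p Wp _ IH; apply: (sandwich_leq (leqnSn n)); apply: IH.
- move=> n p Wp _ IH; have := IH n (ltnSn n) p Wp.
  elim=> {p Wp} [|a p q _ Sp _ Sq|i j k le_n].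
  + by rewrite mulr0; apply: sandwich0.
  + by rewrite mulrDr -scalerAr; apply: sandwichP.
  + by rewrite !mulrA -exprS; apply: sandwich_monomial.
move=> n p Wp _ IH; have := IH n (ltnSn n) p Wp.
elim=> {p Wp} [|a p q _ Sp _ Sq|[|i] j k le_n].
+ by rewrite mulr0; apply: sandwich0.
+ by rewrite mulrDr -scalerAr; apply: sandwichP.
(* With no [u] in front, the new [v] merges with [v ^+ j]. *)
+ rewrite mul1r mulrA -exprS -[v ^+ _]mul1r -(expr0 u).
  exact: sandwich_monomial.
(* Characteristic zero makes the leading coefficient in [mul_v_sandwich] invertible. *)
have j_neq0 : (j.+1%:R : F) != 0 by rewrite (pcharf0P _).1.
rewrite -[v * _]scale1r -(mulVf j_neq0) -scalerA; apply: sandwichZ.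
(* The error term times [u ^+ k] has length at most [i.+1 + j + k <= n], below the current [n.+1],
   so the outer induction hypothesis applies to it. *)
have Wr := wordsM (mul_v_sandwich i j) (wordsX k words_u).
have := sandwich_leq (leqW le_n) (IH (i.+1 + j + k)%N le_n _ Wr).
rewrite mulrBl -scalerAl !mulrA => Sr.
set R := (X in _ - X * _) in Sr; rewrite -[_ *: _](subrK (R * u ^+ k)).
apply: sandwichD Sr _; rewrite /R mulrDl -!scalerAl -[_ * u * _]mulrA -exprS.
apply: sandwichD; apply: sandwichZ; apply: sandwich_monomial;
  by move: le_n; rewrite ?addnS ?addSn.
Qed.

End TwoGenerators.

(** * Concatenation of finite families *)

Section Glue.
Context (m n : nat).

Definition glue T (f : 'I_m -> T) (g : 'I_n -> T) i :=
  match split i with inl j => f j | inr j => g j end.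

Lemma glue_all T (P : T -> Prop) (f : 'I_m -> T) (g : 'I_n -> T) :
  (forall i, P (f i)) -> (forall i, P (g i)) -> forall i, P (glue f g i).
Proof. by move=> Pf Pg i; rewrite /glue; case: (split i). Qed.

(** This turns a linear combination of two of the explicit sums in [span_mul] into one such sum, as
    [span_mulP] requires. *)
Lemma sum_glue (F : fieldType) (A : algType F) a c d (x y : 'I_m -> A) x' y' :
  a *: (\sum_i c i *: (x i * y i)) + \sum_i d i *: (x' i * y' i) =
  \sum_i glue (fun j => a * c j) d i *: (glue x x' i * glue y y' i).
Proof.
rewrite big_split_ord scaler_sumr; congr (_ + _); apply: eq_bigr => i _.
  by rewrite /glue (unsplitK (inl i)) scalerA.
by rewrite /glue (unsplitK (inr i)).
Qed.

End Glue.

(** * Enveloping algebras of subalgebras, and plus-minus pairs of lines *)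

Section Subalgebras.
Context (F : fieldType) (L : lieVectType F).
Implicit Types (u v w : L) (P M : lieSubalg L) (p q : uenv L).

Lemma lieC u v : lie v u = - lie u v.
Proof.
have lieD x y z : lie (x + y) z = lie x z + lie y z.
  by have := lie_linearl z 1 x y; rewrite !scale1r.
have lieDr x y z : lie x (y + z) = lie x y + lie x z.
  by have := lie_linearr x 1 y z; rewrite !scale1r.
apply/eqP; rewrite -addr_eq0 addrC; have := liexx (u + v).
by rewrite lieD !lieDr !liexx addr0 add0r => ->.
Qed.

HB.instance Definition _ u :=
  GRing.isLinear.Build F L L *:%R (lie u) (lie_linearr u).

(** [uenv_map] is a bare function; packing it as an algebra morphism makes its linearity and
    multiplicativity usable for rewriting. *)
Lemma uenv_subE P : exists g : {lrmorphism uenv (subvs_of P) -> uenv L},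
  (forall u : subvs_of P, g (uenv_in u) = uenv_in (vsval u)) /\
  uenv_sub P = range g.
Proof.
pose f := uenv_map (vsval : {linear subvs_of P -> L}).
have lin : linear (fun u : subvs_of P => uenv_in (vsval u)).
  by move=> a u v; rewrite !linearP.
have morph (u v : subvs_of P) : uenv_in (vsval (lie u v)) =
    uenv_in (vsval u) * uenv_in (vsval v)
    - uenv_in (vsval v) * uenv_in (vsval u).
  by rewrite vsval_lie_morphism uenv_in_lie.
pose g1 := GRing.isLinear.Build F _ _ *:%R f (uenv_lift_linear lin morph).
pose g2 := GRing.isMonoidMorphism.Build _ _ f
  (uenv_lift_monoid_morphism lin morph).
pose g : {lrmorphism uenv (subvs_of P) -> uenv L} := HB.pack f g1 g2.
by exists g; split=> // u; apply: uenv_map_in; apply: vsval_lie_morphism.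
Qed.

Lemma uenv_subX P u n : u \in lieSubalg_vs P -> uenv_sub P (uenv_in u ^+ n).
Proof.
move=> Pu; have [g [g_in ->]] := uenv_subE P.
by exists (uenv_in (Subvs Pu) ^+ n); rewrite // rmorphXn /= g_in.
Qed.

Lemma uenv_sub_ind P (S : uenv L -> Prop) :
  S 1 -> (forall a p q, S p -> S q -> S (a *: p + q)) ->
  (forall p q, S p -> S q -> S (p * q)) ->
  (forall u, u \in lieSubalg_vs P -> S (uenv_in u)) ->
  forall q, uenv_sub P q -> S q.
Proof.
have [g [g_in ->]] := uenv_subE P.
move=> S1 SD SM Sin _ [q _ <-]; elim/uenv_ind: q => [|a p q Sp Sq|p q Sp Sq|u].
- by rewrite rmorph1.
- by rewrite linearP; apply: SD.
- by rewrite rmorphM; apply: SM.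
- by rewrite g_in; apply/Sin/subvsP.
Qed.

Lemma span_mulM (A B : set (uenv L)) p q : A p -> B q -> span_mul A B (p * q).
Proof.
move=> Ap Bq; exists 1%N, (fun=> 1), (fun=> p), (fun=> q).
by split=> //; rewrite big_ord1 scale1r.
Qed.

Lemma span_mul0 (A B : set (uenv L)) : span_mul A B 0.
Proof.
exists 0%N, (fun=> 0), (fun=> 0), (fun=> 0).
by rewrite big_ord0; split=> // -[].
Qed.

Lemma span_mulP (A B : set (uenv L)) a p q :
  span_mul A B p -> span_mul A B q -> span_mul A B (a *: p + q).
Proof.
move=> [m [c [x [y [Ax By ->]]]]] [n [d [x' [y' [Ax' By' ->]]]]].
exists (m + n)%N, (glue (fun j => a * c j) d), (glue x x'), (glue y y').
by split; [apply: glue_all|apply: glue_all|rewrite -sum_glue].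
Qed.

Lemma uenv_sandwich_le P M u v n q :
  u \in lieSubalg_vs P -> v \in lieSubalg_vs M ->
  sandwich_le (uenv_in u) (uenv_in v) n q ->
  span_mul (span_mul (uenv_sub P) (uenv_sub M)) (uenv_sub P) q.
Proof.
move=> Pu Mv; elim=> {q} [|a p q _ Sp _ Sq|i j k _]; first exact: span_mul0.
  exact: span_mulP.
by apply: span_mulM; [apply: span_mulM|]; apply: uenv_subX.
Qed.

Lemma line_lie_closed u x y :
  x \in <[u]>%VS -> y \in <[u]>%VS -> lie x y \in <[u]>%VS.
Proof.
move=> /vlineP[a ->] /vlineP[b ->].
by rewrite linearZ /= lieC linearZ /= liexx scaler0 oppr0 scaler0 mem0v.
Qed.

Definition line_subalg u : lieSubalg L := LieSubalg (@line_lie_closed u).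

(** The image of [lie u v] is a commutator of the generators, hence of length at most 2. The uniform
    bound 2 on [L] also covers the brackets of [u] and [v] with [lie u v], which is what [comm_uw]
    and [comm_vw] ask for. *)
Lemma uenv_words u v :
  (<[u]> + <[v]> + <[lie u v]> = fullv)%VS ->
  (forall x, words_le (uenv_in u) (uenv_in v) 2 (uenv_in x)) /\
  (forall q, exists n, words_le (uenv_in u) (uenv_in v) n q).
Proof.
move=> Lgen.
have Win x : words_le (uenv_in u) (uenv_in v) 2 (uenv_in x).
  have : x \in (<[u]> + <[v]> + <[lie u v]>)%VS by rewrite Lgen memvf.
  move=> /memv_addP[_ /memv_addP[_ /vlineP[a ->] [_ /vlineP[b ->] ->]]].
  move=> [_ /vlineP[c ->] ->]; rewrite -addrA !linearP /=.
  have Wu := wordsS (words_u (uenv_in u) (uenv_in v)).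
  have Wv := wordsS (words_v (uenv_in u) (uenv_in v)).
  apply: wordsP Wu _; apply: wordsP Wv _; rewrite linearZ /=; apply: wordsZ.
  rewrite uenv_in_lie; apply: wordsB; apply: (@wordsM _ _ _ _ 1 1);
    by [apply: words_u|apply: words_v].
split=> //; apply: uenv_ind => [|a p q [m Wp] [n Wq]|p q [m Wp] [n Wq]|x].
- by exists 0%N; apply: words1.
- by exists (maxn m n); apply: wordsP;
    [apply: words_leq Wp; apply: leq_maxl|apply: words_leq Wq; apply: leq_maxr].
- by exists (m + n)%N; apply: wordsM.
- by exists 2%N.
Qed.

Lemma line_plus_minus_pair u v (charF0 : [pchar F] =i pred0) :
  \dim {:L} = 3%N -> lie u v \notin (<[u]> + <[v]>)%VS ->
  plus_minus_pair (line_subalg u) (line_subalg v).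
Proof.
move=> dimL w_notin; split; first by move=> Luv; rewrite Luv memvf in w_notin.
have u0 : u != 0.
  by apply: contraNneq w_notin => ->; rewrite lieC linear0 oppr0 mem0v.
have v0 : v \notin <[u]>%VS.
  apply: contraNN w_notin => /vlineP[a ->].
  by rewrite linearZ /= liexx scaler0 mem0v.
(* Three independent vectors in dimension 3 span [L]. *)
have freeX : free [:: lie u v; v; u].
  rewrite !free_cons nil_free !span_cons span_nil memv0 addv0 u0 v0 !andbT.
  by rewrite addvC w_notin.
have Lgen : (<[u]> + <[v]> + <[lie u v]> = fullv)%VS.
  apply/eqP; rewrite eqEdim subvf dimL.
  move: freeX; rewrite /free !span_cons span_nil addv0 => /eqP /= <-.
  by rewrite addvC [(<[v]> + _)%VS]addvC.
have [Win Wq] := uenv_words Lgen.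
apply/seteqP; split=> q // _; have [n /words_sandwich Sq] := Wq q.
apply: (@uenv_sandwich_le (line_subalg u) (line_subalg v) u v n).
- exact: memv_line.
- exact: memv_line.
- by apply: Sq (esym (uenv_in_lie u v)) _ _ charF0; rewrite -uenv_in_lie.
Qed.

End Subalgebras.

(** The map sending [u] to [u - projv U u] kills [U] but not all of [L]; [f] is a coordinate of this
    map that is nonzero at some [w]. *)
Lemma proper_subspace_functional (F : fieldType) (L : vectType F)
    (U : {vspace L}) : U <> fullv ->
  exists f : {scalar L}, (forall u, u \in U -> f u = 0) /\ exists w, f w != 0.
Proof.
move=> Uproper; have [w Uw] : exists w, projv U w != w.
  apply: contrapT => noW; apply: Uproper; apply/eqP; rewrite eqEsubv subvf /=.
  apply/subvP => w _; have [<-|neq] := eqVneq (projv U w) w.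
    by rewrite memv_proj.
  by case: noW; exists w.
have [i wi] : exists i, coord (vbasis fullv) i (w - projv U w) != 0.
  apply: contrapT => no_i; case/eqP: Uw; apply/esym/eqP; rewrite -subr_eq0.
  rewrite [X in X == _](coord_vbasis (memvf _)) big1 // => i _.
  suff /eqP-> : coord (vbasis fullv) i (w - projv U w) == 0 by rewrite scale0r.
  by apply/negPn/negP => ?; apply: no_i; exists i.
pose f u := coord (vbasis fullv) i (u - projv U u).
have f_lin : scalar f.
  by move=> a u v; rewrite /f !linearB !linearP /=; ring.
pose f1 := GRing.isLinear.Build F L F *%R f f_lin.
exists (HB.pack_for {scalar L} f f1); split=> [u Uu|]; last by exists w.
by rewrite /= /f projv_id // subrr linear0.
Qed.

(** * Obstruction for brackets of the form [z v *: u - z u *: v] *)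

Section ScalarBracket.
Context (F : fieldType) (L : lieVectType F).

(* Under lieE this is a Lie representation in which an element acts diagonally
   exactly when f vanishes on it. *)
Definition triangular_rep (z f : {scalar L}) (u : L) : 'M[F]_2 :=
  \matrix_(i, j) if i == 0 then (if j == 0 then - z u else f u) else 0.

Variable z : {scalar L}.
Hypothesis lieE : forall u v : L, lie u v = z v *: u - z u *: v.

Lemma triangular_rep_linear f : linear (triangular_rep z f).
Proof.
move=> a u v; apply/matrixP => i j; rewrite !mxE !linearP /=.
by case: eqP => _; [case: eqP => _|]; ring.
Qed.

(** The upper right entry of the commutator is [z v * f u - z u * f v], which is [f (lie u v)]. Its
    diagonal vanishes, in accordance with [z (lie u v) = 0]. *)
Lemma triangular_rep_lie f u v : triangular_rep z f (lie u v) =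
  triangular_rep z f u * triangular_rep z f v
  - triangular_rep z f v * triangular_rep z f u.
Proof.
apply/matrixP => i j; rewrite !mxE !big_ord_recl !big_ord0 !mxE /= lieE.
rewrite !linearB !linearZ /=.
by case: eqP => _; [case: eqP => _|]; ring.
Qed.

Lemma no_plus_minus_pair : ~ has_plus_minus_pair L.
Proof.
move=> [P [M [/proper_subspace_functional[f [f0 [w fw]]] UPMP]]].
have [[g g_in] _] := uenv_universal (triangular_rep_linear f)
  (triangular_rep_lie f).
(* Matrices with zero upper right entry form a subalgebra. It contains the images of [uenv_sub P]
   and [uenv_sub M], since [f] kills [P + M], but not that of [w]. *)
pose S (q : uenv L) := g q 0 1 = 0.
have SP a p q : S p -> S q -> S (a *: p + q).
  by rewrite /S linearP !mxE => -> ->; rewrite mulr0 addr0.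
have SM p q : S p -> S q -> S (p * q).
  rewrite /S rmorphM !mxE !big_ord_recl big_ord0 => p0 q0.
  have -> : lift ord0 ord0 = 1 :> 'I_2 by apply: val_inj.
  by rewrite p0 q0 mulr0 mul0r !addr0.
have Sspan (A B : set (uenv L)) :
    (forall q, A q -> S q) -> (forall q, B q -> S q) ->
  forall q, span_mul A B q -> S q.
  move=> SA SB q [n [c [a [b [Aa Bb ->]]]]].
  rewrite /S linear_sum summxE big1 // => i _.
  by rewrite linearZ mxE SM ?mulr0 //; [apply: SA|apply: SB].
have Ssub Q : (lieSubalg_vs Q <= P + M)%VS -> forall q, uenv_sub Q q -> S q.
  move=> QPM; apply: uenv_sub_ind => // [|u Qu].
    by rewrite /S rmorph1 mxE.
  by rewrite /S g_in mxE /= f0 // (subvP QPM).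
have : S (uenv_in w).
  have : [set: uenv L]%classic (uenv_in w) by [].
  rewrite UPMP; apply: (Sspan _ _); first apply: (Sspan _ _);
    apply: (Ssub _);
    by [apply: addvSl|apply: addvSr].
by rewrite /S g_in mxE /= => fw0; rewrite fw0 eqxx in fw.
Qed.

End ScalarBracket.

(** Both sides are bilinear: [half] extends the formula in the second argument, then antisymmetry
    reduces the first argument to [half]. *)
Lemma scalar_bracket_basis (F : fieldType) (L : lieVectType F) (z : {scalar L})
    n (e : n.-tuple L) : basis_of fullv e ->
  (forall i j : 'I_n, lie e`_i e`_j = z e`_j *: e`_i - z e`_i *: e`_j) ->
  forall u v, lie u v = z v *: u - z u *: v.
Proof.
move=> e_basis lie_e.
have half (i : 'I_n) v : lie e`_i v = z v *: e`_i - z e`_i *: v.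
  have vE := coord_basis e_basis (memvf v).
  rewrite vE !linear_sum /= scaler_suml -big_split /=.
  apply: eq_bigr => j _; rewrite !linearZ /= lie_e scalerBr scalerA.
  by rewrite !scalerA [z e`_i * _]mulrC scalerN.
move=> u v; have uE := coord_basis e_basis (memvf u).
rewrite lieC uE !linear_sum /= scaler_suml -sumrB.
apply: eq_bigr => i _; rewrite !linearZ /= lieC half opprK.
by rewrite scalerBr scalerN !scalerA.
Qed.

(** * Three dimensional Lie algebras in which each bracket lies in the span of its arguments *)

Section Classification.
Context (F : fieldType) (L : lieVectType F).
Hypothesis dimL : \dim {:L} = 3%N.

Lemma basis3 : exists e0 e1 e2, basis_of {:L} [tuple e0; e1; e2].
Proof.
have : size (vbasis {:L}) = 3 by rewrite size_tuple.
have := vbasisP {:L}.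
by case: (tval _) => [|a [|b [|c []]]] // abc _; exists a, b, c.
Qed.

Lemma scalar_bracket_exists :
  (forall u v : L, lie u v \in (<[u]> + <[v]>)%VS) ->
  exists z : {scalar L}, forall u v, lie u v = z v *: u - z u *: v.
Proof.
move=> lie_in.
have [e0 [e1 [e2 e_basis]]] := basis3.
have lie_inE (u v : L) : exists a b, lie u v = a *: u + b *: v.
  have /memv_addP[_ /vlineP[a ->] [_ /vlineP[b ->] ->]] := lie_in u v.
  by exists a, b.
have [a01 [b01 E01]] := lie_inE e0 e1.
have [a02 [b02 E02]] := lie_inE e0 e2.
have [a12 [b12 E12]] := lie_inE e1 e2.
pose e := [tuple e0; e1; e2]; have e_free := basis_free e_basis.
have coordE (j i : 'I_3) : coord e j e`_i = (i == j)%:R :=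
  coord_free i j e_free.
have [c00 c01 c02] : [/\ coord e 0 e0 = 1, coord e 0 e1 = 0 & coord e 0 e2 = 0].
  by split; [apply: (coordE 0 0)|apply: (coordE 0 1)|apply: (coordE 0 2)].
have [c10 c11 c12] : [/\ coord e 1 e0 = 0, coord e 1 e1 = 1 & coord e 1 e2 = 0].
  by split; [apply: (coordE 1 0)|apply: (coordE 1 1)|apply: (coordE 1 2)].
have [c20 c21 c22] : [/\ coord e 2 e0 = 0, coord e 2 e1 = 0 & coord e 2 e2 = 1].
  by split; [apply: (coordE 2 0)|apply: (coordE 2 1)|apply: (coordE 2 2)].
have simpc := (linearD, linearN, linearZ, c00, c01, c02, c10, c11, c12,
  c20, c21, c22, mulr0, mulr1, addr0, add0r, oppr0).
(* The bracket of [e0] with [e1 + e2] lies in the span of these two vectors, so its coordinates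
   along [e1] and [e2] agree. The next two equalities come from the other two choices of a single
   basis vector. *)
have b_eq : b01 = b02.
  have [p [q]] := lie_inE e0 (e1 + e2); rewrite linearD /= E01 E02 => Epq.
  have := congr1 (coord e 1) Epq; have := congr1 (coord e 2) Epq.
  by rewrite !simpc /= !simpc => -> ->.
have ab_eq : - a01 = b12.
  have [p [q]] := lie_inE e1 (e0 + e2); rewrite linearD /= lieC E01 E12 => Epq.
  have := congr1 (coord e 0) Epq; have := congr1 (coord e 2) Epq.
  by rewrite !simpc /= !simpc => -> ->.
have a_eq : a02 = a12.
  have [p [q]] := lie_inE e2 (e0 + e1).
  rewrite linearD /= lieC [lie e2 e1]lieC E02 E12 => Epq.
  have := congr1 (coord e 0) Epq; have := congr1 (coord e 1) Epq.
  by rewrite !simpc /= !simpc => <- /oppr_inj.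
(* These values are forced by comparing [lie e0 e1] and [lie e0 e2] with [z v *: u - z u *: v]; the
   three equalities make them fit [lie e1 e2] as well. *)
have [z zE] := linear_of_free e ([:: - b01; a01; a02] : seq F^o).
have [z0 z1 z2] := zE e_free erefl.
exists (z : {scalar L}); apply: scalar_bracket_basis e_basis _.
move=> [[|[|[|//]]] ?] [[|[|[|//]]] ?] /=; rewrite ?liexx ?subrr //.
all: rewrite ?z0 ?z1 ?z2 ?E01 ?E02 ?E12 -?ab_eq -?a_eq -?b_eq ?scaleNr ?opprK.
all: rewrite // lieC ?E01 ?E02 ?E12 -?ab_eq -?a_eq -?b_eq ?scaleNr opprD ?opprK.
all: by rewrite // addrC.
Qed.

Lemma lie_g_bracketE (u v : lie_g F) :
  lie u v = (v : 'rV_3) 0 2 *: u - (u : 'rV_3) 0 2 *: v.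
Proof. by []. Qed.

Lemma abelian_or_lie_g (z : {scalar L}) :
  (forall u v, lie u v = z v *: u - z u *: v) ->
  lie_abelian L \/ lie_isomorphic L (lie_g F).
Proof.
move=> lieE; have [z0|[w zw]] : (forall u, z u = 0) \/ exists w, z w != 0.
- have [zw|z0] := pselect (exists w, z w != 0); [by right|left=> u].
  by apply/eqP/negPn/negP => zu; apply: z0; exists u.
- by left=> u v; rewrite lieE !z0 !scale0r subr0.
right.
(* A basis is permuted so that [z] is nonzero on its last vector. *)
have [e0 [e1 [e2 [e_basis ze]]]] :
    exists e0 e1 e2, basis_of {:L} [tuple e0; e1; e2] /\ z e2 != 0.
  have [a [b [c abc]]] := basis3.
  have [zc|zc] := eqVneq (z c) 0; last by exists a, b, c.
  have [zb|zb] := eqVneq (z b) 0; last first.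
    exists a, c, b; split=> //.
    rewrite -(perm_basis _ (_ : perm_eq [:: a; b; c] _)) //.
    by rewrite perm_cons (perm_catC [:: b] [:: c]).
  have [za|za] := eqVneq (z a) 0; last first.
    exists b, c, a; split=> //.
    rewrite -(perm_basis _ (_ : perm_eq [:: a; b; c] _)) //.
    by rewrite (perm_catC [:: a] [:: b; c]).
  case/eqP: zw; rewrite (coord_basis abc (memvf w)) linear_sum big1 // => i _.
  by rewrite linearZ /=; case: i => [[|[|[|//]]] ilt] /=;
    rewrite ?za ?zb ?zc mulr0.
pose e := [tuple e0; e1; e2]; have e_free := basis_free e_basis.
have coord_e u : u = coord e 0 u *: e0 + coord e 1 u *: e1 + coord e 2 u *: e2.
  rewrite {1}(coord_basis e_basis (memvf u)) !big_ord_recl big_ord0 addr0 addrA.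
  have -> : lift ord0 ord0 = 1 :> 'I_3 by apply: val_inj.
  by have -> : lift ord0 (lift ord0 ord0) = 2 :> 'I_3 by apply: val_inj.
have coordE (j i : 'I_3) : coord e j e`_i = (i == j)%:R :=
  coord_free i j e_free.
(* The bracket of [lie_g] takes its coefficients from the third entry; placing [z u] there makes [f]
   a Lie morphism by [lieE] and linearity. *)
pose f u : lie_g F := \row_i [:: coord e 0 u; coord e 1 u; z u]`_i.
have f_lin : linear f.
  move=> a u v; apply/rowP => -[[|[|[|//]]] ilt]; by rewrite !mxE /= linearP.
pose f1 := GRing.isLinear.Build F L (lie_g F) *:%R f f_lin.
pose fL := HB.pack_for {linear L -> lie_g F} f f1.
have zE u : z u = coord e 0 u * z e0 + coord e 1 u * z e1 + coord e 2 u * z e2.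
  by rewrite {1}(coord_e u) !linearD !linearZ.
exists fL; split=> [u v|].
  by rewrite lieE linearB !linearZ lie_g_bracketE /= !mxE scalerN.
(* The coefficient of [e2] solves [z (g r) = x 2], and [z e2 != 0] permits the division. *)
pose g (r : lie_g F) := let x i := (r : 'rV_3) 0 i in
  x 0 *: e0 + x 1 *: e1 + ((x 2 - x 0 * z e0 - x 1 * z e1) / z e2) *: e2.
exists g => [u|r].
  rewrite /g !mxE /= [RHS]coord_e (zE u); congr (_ + _ *: _).
  by field.
have c0 : coord e 0 (g r) = (r : 'rV_3) 0 0.
  rewrite /g !linearD !linearZ /= (coordE 0 0) (coordE 0 1) (coordE 0 2) /=.
  by ring.
have c1 : coord e 1 (g r) = (r : 'rV_3) 0 1.
  rewrite /g !linearD !linearZ /= (coordE 1 0) (coordE 1 1) (coordE 1 2) /=.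
  by ring.
have zr : z (g r) = (r : 'rV_3) 0 2.
  rewrite /g !linearD !linearZ /=.
  by field.
apply/rowP => -[[|[|[|//]]] ilt]; rewrite mxE /=.
- by rewrite c0; congr ((r : 'rV_3) _ _); apply: val_inj.
- by rewrite c1; congr ((r : 'rV_3) _ _); apply: val_inj.
- by rewrite zr; congr ((r : 'rV_3) _ _); apply: val_inj.
Qed.

(** The functional is zero in the abelian case; otherwise it is the third coordinate of [lie_g]
    pulled back along the isomorphism. *)
Lemma abelian_or_lie_g_scalar_bracket :
  lie_abelian L \/ lie_isomorphic L (lie_g F) ->
  exists z : {scalar L}, forall u v, lie u v = z v *: u - z u *: v.
Proof.
case=> [ab|[f [f_lie f_bij]]].
  have z_lin : scalar (fun _ : L => 0 : F) by move=> a u v; rewrite mulr0 addr0.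
  pose z1 := GRing.isLinear.Build F L F *%R _ z_lin.
  exists (HB.pack_for {scalar L} (fun _ : L => 0 : F) z1) => u v /=.
  by rewrite ab !scale0r subr0.
pose z u : F := (f u : 'rV_3) 0 2.
have z_lin : scalar z by move=> a u v; rewrite /z linearP !mxE.
pose z1 := GRing.isLinear.Build F L F *%R z z_lin.
exists (HB.pack_for {scalar L} z z1) => u v /=; apply: (bij_inj f_bij).
by rewrite f_lie linearB !linearZ /= scalerN lie_g_bracketE.
Qed.

End Classification.

Theorem theorem2p3 (F : fieldType) (charF0 : [pchar F] =i pred0)
    (L : lieVectType F) (dimL : \dim {:L} = 3%N) :
  has_plus_minus_pair L <-> ~ lie_abelian L /\ ~ lie_isomorphic L (lie_g F).
Proof.
split=> [pm|[nab niso]].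
  suff not_both : ~ (lie_abelian L \/ lie_isomorphic L (lie_g F)).
    by split=> h; apply: not_both; [left|right].
  by move=> /abelian_or_lie_g_scalar_bracket[z /no_plus_minus_pair]; apply.
(* Without a plus-minus pair no two lines can form one, so every bracket lies in the span of its
   arguments and the classification applies. *)
apply: contrapT => no_pm.
have lie_in (u v : L) : lie u v \in (<[u]> + <[v]>)%VS.
  apply: contrapT => /negP /(line_plus_minus_pair charF0 dimL) pm.
  by case: no_pm; exists (line_subalg u), (line_subalg v).
have [z /abelian_or_lie_g[]//] := scalar_bracket_exists dimL lie_in.
Qed.
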